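(* Let $p,q,s$ be complex constants with $p\ne0$ and let $(a_n^k)_{n,k\ge0}$ be complex numbers satisfying $$a_n^k=\frac{pn+q}{k}\,a_n^{k-1}+\frac{s}{k}\,a_{n+1}^{k-1}\qquad(n\ge0,\ k\ge1).$$ Then, as formal power series, $$\bar a(t)=\exp(qt)\;A\!\left(\frac{s}{p}\bigl(\exp(pt)-1\bigr)\right).$$
   Context: Superscripts in $a_n^k$ are indices, not powers. The initial sequence $(a_n^0)_{n\ge0}$ is arbitrary. $A(t)=\sum_{n\ge0}a_n^0\frac{t^n}{n!}$ is the exponential generating function of the initial sequence and $\bar a(t)=\sum_{n\ge0}a_0^n t^n$ is the ordinary generating function of the final sequence $(a_0^n)_{n\ge0}$. *)

(* Defs.v *)
From HB Require Import structures.
From mathcomp Require Import all_boot all_order all_algebra.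
From mathcomp Require Import boolp reals complex.

Set Implicit Arguments.
Unset Strict Implicit.
Unset Printing Implicit Defensive.

Import GRing.Theory.
Local Open Scope ring_scope.

(* The formal power series \sum_n f_n t^n, given by its coefficients.  It is a
   record rather than an alias of nat -> K so that the product below cannot be
   confused with the pointwise product of functions. *)
Record fps (K : Type) := FPS { fcoef : nat -> K }.

Section FpsRing.
Variable K : comNzRingType.
Implicit Types f g h : fps K.

Lemma fpsP f g : fcoef f =1 fcoef g -> f = g.
Proof. by case: f g => [f] [g] /= /funext ->. Qed.

HB.instance Definition _ := gen_eqMixin (fps K).
HB.instance Definition _ := gen_choiceMixin (fps K).

Definition fps_zero : fps K := FPS (fun=> 0).
Definition fps_opp f := FPS (fun n => - fcoef f n).
Definition fps_add f g := FPS (fun n => fcoef f n + fcoef g n).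
Definition fps_one : fps K := FPS (fun n => (n == 0)%:R).
Definition fps_mul f g :=
  FPS (fun n => \sum_(i < n.+1) fcoef f i * fcoef g (n - i)%N).
Definition fps_scale (c : K) f := FPS (fun n => c * fcoef f n).

Fact fps_addA : associative fps_add.
Proof. by move=> f g h; apply: fpsP => n; apply: addrA. Qed.
Fact fps_addC : commutative fps_add.
Proof. by move=> f g; apply: fpsP => n; apply: addrC. Qed.
Fact fps_add0 : left_id fps_zero fps_add.
Proof. by move=> f; apply: fpsP => n; apply: add0r. Qed.
Fact fps_addN : left_inverse fps_zero fps_opp fps_add.
Proof. by move=> f; apply: fpsP => n; apply: addNr. Qed.

HB.instance Definition _ := GRing.isZmodule.Build (fps K)
  fps_addA fps_addC fps_add0 fps_addN.

Definition fps_trunc (m : nat) f : {poly K} := \poly_(i < m) fcoef f i.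

Lemma coef_fps_mul_trunc m n f g : (n < m)%N ->
  fcoef (fps_mul f g) n = (fps_trunc m f * fps_trunc m g)`_n.
Proof.
move=> nm; rewrite coefM; apply: eq_bigr => i _; rewrite !coef_poly.
by rewrite (leq_ltn_trans _ nm) ?(leq_ltn_trans (leq_subr i n) nm) // -ltnS.
Qed.

Lemma coef_fps_trunc m n f : (n < m)%N -> (fps_trunc m f)`_n = fcoef f n.
Proof. by move=> nm; rewrite coef_poly nm. Qed.

Fact fps_mulA : associative fps_mul.
Proof.
move=> f g h; apply: fpsP => n.
have -> : fcoef (fps_mul f (fps_mul g h)) n =
    (fps_trunc n.+1 f * (fps_trunc n.+1 g * fps_trunc n.+1 h))`_n.
  rewrite coefM; apply: eq_bigr => i _.
  rewrite coef_fps_trunc // (@coef_fps_mul_trunc n.+1) //.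
  by rewrite ltnS leq_subr.
rewrite mulrA coefM; apply: eq_bigr => i _.
by rewrite coef_fps_trunc ?ltnS ?leq_subr // (@coef_fps_mul_trunc n.+1).
Qed.
Fact fps_mulC : commutative fps_mul.
Proof.
by move=> f g; apply: fpsP => n; rewrite !(@coef_fps_mul_trunc n.+1) // mulrC.
Qed.
Fact fps_mul1 : left_id fps_one fps_mul.
Proof.
move=> f; apply: fpsP => n /=; rewrite big_ord_recl /= mul1r subn0.
by rewrite big1 ?addr0 // => i _; rewrite mul0r.
Qed.
Fact fps_mulDl : left_distributive fps_mul fps_add.
Proof.
move=> f g h; apply: fpsP => n /=; rewrite -big_split.
by apply: eq_bigr => i _; rewrite mulrDl.
Qed.
Fact fps_oner_neq0 : fps_one != 0.
Proof.
apply/eqP => /(congr1 (fun f => fcoef f 0%N)) /= /eqP.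
by rewrite oner_eq0.
Qed.

HB.instance Definition _ := GRing.Zmodule_isComNzRing.Build (fps K)
  fps_mulA fps_mulC fps_mul1 fps_mulDl fps_oner_neq0.

Fact fps_scaleA c d f : fps_scale c (fps_scale d f) = fps_scale (c * d) f.
Proof. by apply: fpsP => n; apply: mulrA. Qed.
Fact fps_scale1 : left_id 1 fps_scale.
Proof. by move=> f; apply: fpsP => n; apply: mul1r. Qed.
Fact fps_scaleDr : right_distributive fps_scale +%R.
Proof. by move=> c f g; apply: fpsP => n; apply: mulrDr. Qed.
Fact fps_scaleDl f : {morph fps_scale^~ f : c d / c + d}.
Proof. by move=> c d; apply: fpsP => n; apply: mulrDl. Qed.

HB.instance Definition _ := GRing.Zmodule_isLmodule.Build K (fps K)
  fps_scaleA fps_scale1 fps_scaleDr fps_scaleDl.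

Definition fps_X : fps K := FPS (fun n => (n == 1)%:R).

(* The substitution f(g(t)) = \sum_k f_k g(t)^k.  It is meaningful only when g
   has no constant term: then g^k has no term of degree below k, so that k <= n
   suffices for the coefficient of t^n (see fps_compE). *)
Definition fps_comp f g : fps K :=
  FPS (fun n => \sum_(k < n.+1) fcoef f k * fcoef (g ^+ k) n).

Lemma fps_expr_low g k n : fcoef g 0%N = 0 -> (n < k)%N -> fcoef (g ^+ k) n = 0.
Proof.
move=> g0; elim: k n => // k IHk n nk; rewrite exprS.
apply: big1 => -[[|i] ltin] _ /=; first by rewrite g0 mul0r.
by rewrite IHk ?mulr0 //; move: nk ltin; case: n => // n nk _; rewrite subSS
  (leq_ltn_trans (leq_subr i n)).
Qed.

Lemma fps_compE f g m n : fcoef g 0%N = 0 -> (n < m)%N ->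
  fcoef (fps_comp f g) n = \sum_(k < m) fcoef f k * fcoef (g ^+ k) n.
Proof.
move=> g0 nm; rewrite [RHS](bigID (fun k : 'I_m => (k < n.+1)%N)) /=.
rewrite [X in _ + X]big1 ?addr0 => [|k]; last first.
  by rewrite -leqNgt => nk; rewrite fps_expr_low ?mulr0.
by rewrite (big_ord_widen m (fun k => fcoef f k * fcoef (g ^+ k) n)).
Qed.

End FpsRing.

Definition ogf (K : Type) (u : nat -> K) : fps K := FPS u.

Definition egf (K : fieldType) (u : nat -> K) : fps K :=
  FPS (fun n => u n / n`!%:R).

(* exp(f(t)), for f without constant term. *)
Definition fps_exp (K : fieldType) (f : fps K) : fps K :=
  fps_comp (egf (fun=> 1)) f.

(* Main.v *)
Require Import Defs.
From mathcomp Require Import all_boot all_order all_algebra.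
From mathcomp Require Import reals complex.

Import GRing.Theory.
Local Open Scope ring_scope.

(** Put [E = exp(qt)], [P = exp(pt)], [g = (s/p)(P - 1)] and
    [G_n = E P^n A^(n)(g)], with [A^(n)] the n-th derivative of [A].  As
    [g' = s P], the chain rule gives [G_n' = (pn + q) G_n + s G_(n+1)], which is
    the recurrence satisfied by the coefficients [a n k] of [t^k].  Since
    [G_n] has constant term [a n 0], it follows that [G_n] is the generating
    function of [a n], and [n = 0] is the claim. *)

Definition fps_deriv {K : comNzRingType} (f : fps K) : fps K :=
  FPS (fun n => n.+1%:R * fcoef f n.+1).

Section Derivation.
Variable K : comNzRingType.
Implicit Types f g : fps K.

Lemma fcoefD f g n : fcoef (f + g) n = fcoef f n + fcoef g n.
Proof. by []. Qed.

Lemma fcoefN f n : fcoef (- f) n = - fcoef f n.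
Proof. by []. Qed.

Lemma fcoefZ (c : K) f n : fcoef (c *: f) n = c * fcoef f n.
Proof. by []. Qed.

Lemma fcoef1 n : fcoef (1 : fps K) n = (n == 0)%:R.
Proof. by []. Qed.

Lemma fcoefM f g n :
  fcoef (f * g) n = \sum_(i < n.+1) fcoef f i * fcoef g (n - i)%N.
Proof. by []. Qed.

Lemma fcoef0M f g : fcoef (f * g) 0 = fcoef f 0 * fcoef g 0.
Proof. by rewrite fcoefM big_ord1. Qed.

Lemma fcoef0X f n : fcoef (f ^+ n) 0 = fcoef f 0 ^+ n.
Proof. by elim: n => [|n IHn]; rewrite ?fcoef1 // !exprS fcoef0M IHn. Qed.

Lemma fcoef0_comp f g : fcoef (fps_comp f g) 0 = fcoef f 0.
Proof. by rewrite /= big_ord1 expr0 fcoef1 mulr1. Qed.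

Lemma fps_scaleAl (c : K) f g : c *: (f * g) = (c *: f) * g.
Proof.
apply: fpsP => n; rewrite fcoefZ !fcoefM mulr_sumr.
by apply: eq_bigr => i _; rewrite fcoefZ mulrA.
Qed.

Lemma fps_scaleAr (c : K) f g : c *: (f * g) = f * (c *: g).
Proof. by rewrite mulrC fps_scaleAl mulrC. Qed.

Lemma fps_derivD f g : fps_deriv (f + g) = fps_deriv f + fps_deriv g.
Proof. by apply: fpsP => n; rewrite /= mulrDr. Qed.

Lemma fps_derivN f : fps_deriv (- f) = - fps_deriv f.
Proof. by apply: fpsP => n; rewrite /= mulrN. Qed.

Lemma fps_derivZ (c : K) f : fps_deriv (c *: f) = c *: fps_deriv f.
Proof. by apply: fpsP => n; rewrite /= mulrCA. Qed.

Lemma fps_deriv1 : fps_deriv (1 : fps K) = 0.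
Proof. by apply: fpsP => n; rewrite /= mulr0. Qed.

Lemma fps_derivX : fps_deriv (fps_X K) = 1.
Proof. by apply: fpsP => -[|n]; rewrite /= ?mulr1 ?mulr0. Qed.

Lemma fps_derivM f g :
  fps_deriv (f * g) = fps_deriv f * g + f * fps_deriv g.
Proof.
apply: fpsP => n; rewrite fcoefD !fcoefM /=.
(* The factor [n.+1] is split as [i + (n.+1 - i)] in each term: the weight [i] differentiates [f]
   and kills the first term, the weight [n.+1 - i] differentiates [g] and kills the last one. *)
transitivity (\sum_(i < n.+2)
    (i%:R * (fcoef f i * fcoef g (n.+1 - i)%N) +
     (n.+1 - i)%:R * (fcoef f i * fcoef g (n.+1 - i)%N))).
  rewrite mulr_sumr; apply: eq_bigr => i _.
  by rewrite -mulrDl -natrD subnKC // -ltnS.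
rewrite big_split /=; congr (_ + _).
  rewrite big_ord_recl mul0r add0r; apply: eq_bigr => i _.
  by rewrite /= /bump /= add1n subSS mulrA.
rewrite big_ord_recr /= subnn mul0r addr0; apply: eq_bigr => i _.
by rewrite subSn -1?ltnS //= mulrCA.
Qed.

Lemma fps_derivXn f n :
  fps_deriv (f ^+ n) = n%:R *: (f ^+ n.-1 * fps_deriv f).
Proof.
elim: n => [|n IHn]; first by rewrite scale0r expr0 fps_deriv1.
rewrite exprS fps_derivM IHn -fps_scaleAr mulrA [fps_deriv f * _]mulrC -natr1.
rewrite scalerDl scale1r addrC; congr (_ + _).
(* At [n = 0] the truncated exponent [n.-1] is harmless, its term having the factor 0. *)
by case: n {IHn} => [|n]; rewrite ?scale0r // -exprS.
Qed.

(** Termwise differentiation of the powers of [g]: the power 0 is constant and drops out, and the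
    factor [k.+1] from [g ^+ k.+1] moves onto [f]. *)
Lemma fps_deriv_comp f g : fcoef g 0 = 0 ->
  fps_deriv (fps_comp f g) = fps_comp (fps_deriv f) g * fps_deriv g.
Proof.
move=> g0; apply: fpsP => n; rewrite fcoefM.
transitivity (\sum_(i < n.+1) \sum_(k < n.+1)
    fcoef (fps_deriv f) k * (fcoef (g ^+ k) i * fcoef (fps_deriv g) (n - i)%N)).
  rewrite exchange_big [LHS]/= mulr_sumr big_ord_recl fcoef1 !mulr0 add0r.
  apply: eq_bigr => k _; rewrite -mulr_sumr -fcoefM [lift _ _]/=.
  rewrite mulrCA -[_ * fcoef (g ^+ _) _]/(fcoef (fps_deriv (g ^+ _)) n).
  by rewrite fps_derivXn fcoefZ /= /bump add1n mulrCA mulrA.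
(* The sum defining the coefficient of degree [i] stops at [k = i]; as [g] has no constant term, it
   may run to [n] for every [i], which makes the exchange of sums possible. *)
apply: eq_bigr => i _; rewrite (@fps_compE _ _ _ n.+1) // mulr_suml.
by apply: eq_bigr => k _; rewrite mulrA.
Qed.

End Derivation.

Section CharacteristicZero.
Variable K : numFieldType.

Lemma fps_deriv_egf (u : nat -> K) :
  fps_deriv (egf u) = egf (fun n => u n.+1).
Proof.
apply: fpsP => n; rewrite /= factS natrM.
have n1_neq0 : n.+1%:R != 0 :> K by rewrite Num.Theory.pnatr_eq0.
by rewrite invfM mulrCA; congr (_ * _); rewrite mulrA divff ?mul1r.
Qed.

Lemma fcoef0_exp (f : fps K) : fcoef (fps_exp f) 0 = 1.
Proof. by rewrite fcoef0_comp /= divr1. Qed.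

Lemma fps_deriv_expZX (c : K) :
  fps_deriv (fps_exp (c *: fps_X K)) = c *: fps_exp (c *: fps_X K).
Proof.
rewrite fps_deriv_comp ?fcoefZ /= ?mulr0 // fps_deriv_egf.
by rewrite fps_derivZ fps_derivX -fps_scaleAr mulr1.
Qed.

Variables (p q s : K) (a : nat -> nat -> K).

Let E := fps_exp (q *: fps_X K).
Let P := fps_exp (p *: fps_X K).
Let g := (s / p) *: (P - 1).
(** By [fps_deriv_egf], shifting the sequence by [n] yields the n-th derivative of its exponential
    generating function. *)
Let G n := E * P ^+ n * fps_comp (egf (fun m => a (m + n) 0)) g.

Let fcoef0_g : fcoef g 0 = 0.
Proof. by rewrite fcoefZ fcoefD fcoefN fcoef0_exp fcoef1 subrr mulr0. Qed.

Let fps_deriv_g : p != 0 -> fps_deriv g = s *: P.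
Proof.
move=> p_neq0; rewrite fps_derivZ fps_derivD fps_derivN fps_deriv1 subr0.
by rewrite fps_deriv_expZX scalerA divfK.
Qed.

Let fps_deriv_expn n : fps_deriv (P ^+ n) = (p * n%:R) *: P ^+ n.
Proof.
rewrite fps_derivXn fps_deriv_expZX -fps_scaleAr scalerA [p * _]mulrC.
by case: n => [|n]; rewrite ?mul0r ?scale0r // -exprSr.
Qed.

(** In the product rule [E] contributes [q] and [P ^+ n] contributes [p * n]; the composition brings
    out [s *: P] and shifts the sequence once more, giving [G n.+1]. *)
Let fps_deriv_G n : p != 0 ->
  fps_deriv (G n) = (p * n%:R + q) *: G n + s *: G n.+1.
Proof.
move=> p_neq0; rewrite /G 2!fps_derivM fps_deriv_comp // fps_deriv_g //.
rewrite fps_deriv_expZX fps_deriv_expn fps_deriv_egf.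
have -> : egf (fun m => a (m.+1 + n)%N 0) = egf (fun m => a (m + n.+1)%N 0).
  by apply: fpsP => m; rewrite /= addnS.
rewrite exprSr -!fps_scaleAr -!fps_scaleAl -scalerDl addrC [_ + q]addrC.
rewrite -fps_scaleAl [RHS]addrC; congr (s *: _ + _).
by rewrite -!mulrA [P * _]mulrC.
Qed.

Lemma ogf_recurrence (p_neq0 : p != 0)
    (a_rec : forall n k, a n k.+1 =
      (p * n%:R + q) / k.+1%:R * a n k + s / k.+1%:R * a n.+1 k) n :
  ogf (a n) = E * P ^+ n * fps_comp (egf (fun m => a (m + n) 0)) g.
Proof.
(* The induction keeps [n] general, since [a n k.+1] also involves [a n.+1 k]. *)
apply: fpsP => k; rewrite -/(G n) [LHS]/=; elim: k n => [|k IHk] n.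
  rewrite !fcoef0M fcoef0X !fcoef0_exp fcoef0_comp expr1n !mul1r /=.
  by rewrite add0n divr1.
have k1_neq0 : k.+1%:R != 0 :> K by rewrite Num.Theory.pnatr_eq0.
(* Multiplying by [k.+1] turns the right side into a coefficient of the derivative of [G n] and
   clears the denominators of the recurrence. *)
apply: (mulfI k1_neq0).
rewrite -[RHS]/(fcoef (fps_deriv (G n)) k) fps_deriv_G // fcoefD !fcoefZ -!IHk.
rewrite a_rec mulrDr; congr (_ + _);
  by rewrite mulrA [k.+1%:R * _]mulrC divfK.
Qed.

End CharacteristicZero.

(* a n k is the entry with lower index n and upper index k. *)
Theorem theorem24 (R : realType) (p q s : R[i]) (a : nat -> nat -> R[i])
    (hp : p != 0)
    (ha : forall n k : nat, (1 <= k)%N ->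
      a n k = (p * n%:R + q) / k%:R * a n k.-1 + s / k%:R * a n.+1 k.-1) :
  ogf (fun n => a 0%N n) =
  fps_exp (q *: fps_X R[i]) *
    fps_comp (egf (fun n => a n 0%N))
      ((s / p) *: (fps_exp (p *: fps_X R[i]) - 1)).
Proof.
have -> : egf (fun n => a n 0%N) = egf (fun m => a (m + 0)%N 0%N).
  by apply: fpsP => m; rewrite /= addn0.
rewrite (ogf_recurrence _ p q s) // ?mulr1 // => n k.
exact: ha.
Qed.
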